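(* Suppose $G$ has maximum reduced Sombor index $SO_{red}$ among all $n$-vertex graphs with cyclomatic number $\nu$. If $0\le \nu\le n-2$, then $G\cong H_{n,\nu}$ and $$SO_{red}(G)=(n-\nu-2)(n-2)+\nu\sqrt{(n-2)^2+1}+\nu\sqrt{\nu^2+1}+\sqrt{(n-2)^2+\nu^2}.$$
   Context: All graphs are finite, undirected and simple. $\deg_G(v)$ denotes the degree of the vertex $v$ in $G$. The reduced Sombor index of $G$ is $SO_{red}(G)=\sum_{uv\in E(G)}\sqrt{(\deg_G(u)-1)^2+(\deg_G(v)-1)^2}$. The cyclomatic number of a graph with $n$ vertices, $m$ edges and $k$ connected components is $m-n+k$. $S_n$ is the star on $n$ vertices (one center adjacent to the other $n-1$ vertices, which are called pendent). For $0\le\nu\le n-2$, $H_{n,\nu}$ is the graph obtained from the star $S_n$ by adding $\nu$ edges between one fixed pendent vertex and $\nu$ other pendent vertices.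
   Formalization: For n = 2, ν = 0 the claim G ≅ H_{n,ν} is made only for connected G, since the edgeless graph on two vertices also has cyclomatic number 0 and the maximum SO_red = 0 but is not isomorphic to H_{2,0}; the formula for SO_red(G) is kept in all cases. *)

(* Defs.v *)
From mathcomp Require Import all_boot all_order all_algebra.
From mathcomp Require Import reals.

Set Implicit Arguments.
Unset Strict Implicit.
Unset Printing Implicit Defensive.

Import Order.TTheory GRing.Theory Num.Theory.

Local Open Scope ring_scope.

Record sgraph : Type := SGraph {
  vertex :> finType;
  adj : rel vertex;
  adj_sym : symmetric adj;
  adj_irrefl : irreflexive adj
}.

Definition deg (G : sgraph) (v : G) : nat := #|[set w | adj v w]|.

Definition edges (G : sgraph) : {set {set G}} :=
  [set [set p.1; p.2] | p : G * G & adj p.1 p.2].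

(* The two ends of an edge e = {u, v} are distinct, so the inner sum is
   (deg u - 1)^2 + (deg v - 1)^2.  The subtraction is taken in R. *)
Definition SOred (R : realType) (G : sgraph) : R :=
  \sum_(e in edges G) Num.sqrt (\sum_(v in e) ((deg v)%:R - 1) ^+ 2).

Definition components (G : sgraph) : nat := n_comp (@adj G) [set: G].

(* m - n + k, computed in int. *)
Definition cyclomatic (G : sgraph) : int :=
  (#|edges G|)%:Z - (#|G|)%:Z + (components G)%:Z.

Definition isomorphic (G H : sgraph) : Prop :=
  exists2 f : G -> H, bijective f & forall x y : G, adj (f x) (f y) = adj x y.

Definition maximal_SOred (R : realType) (n nu : nat) (G : sgraph) : Prop :=
  [/\ #|G| = n, cyclomatic G = nu%:Z
    & forall G' : sgraph, #|G'| = n -> cyclomatic G' = nu%:Z ->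
        SOred R G' <= SOred R G].

Section ExtremalGraph.
Variables n nu : nat.

(* The star S_n on 'I_n, with centre 0. *)
Definition star_adj : rel 'I_n := fun i j => (val i == 0%N) (+) (val j == 0%N).

(* The added edges join the fixed pendent vertex 1 to 2, ..., nu + 1; there are
   exactly nu of them when nu <= n - 2. *)
Definition extra_adj : rel 'I_n :=
  fun i j => (val i == 1%N) && (2 <= val j < nu + 2)%N.

Definition H_adj : rel 'I_n :=
  fun i j => [|| star_adj i j, extra_adj i j | extra_adj j i].

Lemma H_adj_sym : symmetric H_adj.
Proof. by move=> i j; rewrite /H_adj /star_adj addbC [X in _ || X]orbC. Qed.

Lemma H_adj_irrefl : irreflexive H_adj.
Proof.
move=> i; rewrite /H_adj /star_adj /extra_adj addbb orbb /=.
by case: eqP => [->|].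
Qed.

Definition Hgraph : sgraph := SGraph H_adj_sym H_adj_irrefl.

End ExtremalGraph.

(* Main.v *)
Require Import Defs.
From mathcomp Require Import all_boot all_order all_algebra.
From mathcomp Require Import reals.
From mathcomp Require Import ring lra zify.

Import Order.TTheory GRing.Theory Num.Theory.
Local Open Scope ring_scope.
Set Implicit Arguments.
Unset Strict Implicit.
Unset Printing Implicit Defensive.

(* Let c be a vertex of maximum degree.  If c ~ w and w has neighbours that are
   neither c nor adjacent to c, moving them from w to c (Kelmans' move) keeps
   the cyclomatic number and increases SO_red, by convexity of the Euclidean
   norm.  Joining two components by an edge also keeps the cyclomatic number and
   increases SO_red.  So in a maximal graph c is adjacent to every other vertex,
   and F = G - c has exactly nu edges.
   Put a = n - 2 and let f be the degree in F.  The edges cw contribute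
   sqrt (a^2 + f(w)^2) = a + f(w) psi(f(w)); spreading the excess f(w) psi(f(w))
   evenly over the f(w) edges of F at w gives
     SO_red(G) = (n - 1) a
       + sum over xy in E(F) of psi(f(x)) + psi(f(y)) + sqrt (f(x)^2 + f(y)^2).
   As f(x) + f(y) <= nu + 1 for every edge of F, each summand is at most its
   value for the degrees nu and 1, with equality for all edges only when F is a
   star plus isolated vertices, that is, when G is H_{n,nu}. *)

(** * Inequalities for the Euclidean norm and for edge weights *)

Section RealInequalities.
Variable R : rcfType.
Implicit Types a b p q x y : R.

Definition hyp x y : R := Num.sqrt (x ^+ 2 + y ^+ 2).

Lemma hypC x y : hyp x y = hyp y x.
Proof. by rewrite /hyp addrC. Qed.

Lemma hyp_ge0 x y : 0 <= hyp x y.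
Proof. exact: sqrtr_ge0. Qed.

Lemma sqr_hyp x y : hyp x y ^+ 2 = x ^+ 2 + y ^+ 2.
Proof. by rewrite sqr_sqrtr // addr_ge0 // sqr_ge0. Qed.

Lemma hyp0 x : 0 <= x -> hyp x 0 = x.
Proof. by move=> x0; rewrite /hyp expr0n addr0 sqrtr_sqr ger0_norm. Qed.

Lemma ler_hyp p q x y : 0 <= p -> p <= q -> 0 <= x -> x <= y -> hyp p x <= hyp q y.
Proof.
move=> p0 pq x0 xy; apply: ler_wsqrtr.
by rewrite lerD // lerXn2r ?nnegrE // (le_trans _ pq, le_trans _ xy).
Qed.

Lemma hyp_lt_sqr p q x y :
  p ^+ 2 + x ^+ 2 < q ^+ 2 + y ^+ 2 -> hyp p x < hyp q y.
Proof.
move=> lt; rewrite /hyp ltr_sqrt //; apply: le_lt_trans lt.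
by rewrite addr_ge0 // sqr_ge0.
Qed.

(** Convexity of [hyp] in its first argument. The squared norms grow by [2 * d] in total, so after
    squaring it suffices that [P * Q <= d + P' * Q']. *)
Lemma hyp_spread p q b y : 0 <= b -> b <= q -> q <= p ->
  hyp p y + hyp q y <= hyp (p + b) y + hyp (q - b) y.
Proof.
move=> b0 bq qp.
set P := hyp p y; set Q := hyp q y; set P' := hyp (p + b) y; set Q' := hyp (q - b) y.
have P0 : 0 <= P := hyp_ge0 _ _. have Q0 : 0 <= Q := hyp_ge0 _ _.
have P0' : 0 <= P' := hyp_ge0 _ _. have Q0' : 0 <= Q' := hyp_ge0 _ _.
have EP : P ^+ 2 = p ^+ 2 + y ^+ 2 := sqr_hyp _ _.
have EQ : Q ^+ 2 = q ^+ 2 + y ^+ 2 := sqr_hyp _ _.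
have EP' : P' ^+ 2 = (p + b) ^+ 2 + y ^+ 2 := sqr_hyp _ _.
have EQ' : Q' ^+ 2 = (q - b) ^+ 2 + y ^+ 2 := sqr_hyp _ _.
pose d := b * (p - q + b); pose m := p * q + y ^+ 2.
have d0 : 0 <= d by rewrite /d mulr_ge0 //; lra.
(* Lagrange's identity for the plane vectors (p, y) and (q, y): [m] is their inner product,
   [y * (p - q)] their determinant. Spreading lowers the first by [d] and does not shrink the second
   in absolute value. *)
have EPQ : (P * Q) ^+ 2 = m ^+ 2 + y ^+ 2 * (p - q) ^+ 2.
  by rewrite exprMn EP EQ /m; ring.
have EPQ' : (P' * Q') ^+ 2 = (m - d) ^+ 2 + y ^+ 2 * (p - q + 2 * b) ^+ 2.
  by rewrite exprMn EP' EQ' /m /d; ring.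
have PQ0' : 0 <= P' * Q' by rewrite mulr_ge0.
have md : m - d <= P' * Q'.
  have [le0|gt0] := lerP (m - d) 0; first exact: le_trans le0 PQ0'.
  rewrite -(@ler_pXn2r _ 2%N) ?nnegrE ?(ltW gt0) // EPQ' lerDl.
  by rewrite mulr_ge0 // sqr_ge0.
have key : P * Q <= d + P' * Q'.
  rewrite -(@ler_pXn2r _ 2%N) ?nnegrE ?mulr_ge0 ?addr_ge0 //.
  rewrite sqrrD EPQ EPQ'.
  have s : y ^+ 2 * (p - q) ^+ 2 <= y ^+ 2 * (p - q + 2 * b) ^+ 2.
    rewrite ler_wpM2l ?sqr_ge0 // lerXn2r ?nnegrE; lra.
  have := mulr_ge0 d0 (_ : 0 <= P' * Q' - (m - d)); rewrite subr_ge0 => /(_ md).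
  nra.
rewrite -(@ler_pXn2r _ 2%N) ?nnegrE ?addr_ge0 //.
rewrite !sqrrD EP EQ EP' EQ'; move: key; rewrite /d => key; nra.
Qed.

(* psi = (hyp a x - a) / x, in a form that needs no case distinction at x = 0. *)
Definition psi a x := x / (hyp a x + a).

Lemma psiE a x : 0 <= a -> 0 <= x -> x * psi a x = hyp a x - a.
Proof.
move=> a0 x0; have h0 := hyp_ge0 a x; have E := sqr_hyp a x; rewrite /psi.
have [z|nz] := eqVneq (hyp a x + a) 0; last by field: E.
have -> : a = 0 by lra.
have x00 : x = 0.
  apply/eqP; rewrite -sqrf_eq0; apply/eqP.
  have hz : hyp a x = 0 by lra.
  have az : a = 0 by lra.
  by move: E; rewrite hz az; lra.
by rewrite x00 hyp0 // mul0r subr0.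
Qed.

(** Cross-multiplied, the claim is the sum of [x * a < y * a] and [x * hyp a y <= y * hyp a x]; the
    latter follows from [x <= y] by squaring. *)
Lemma ltr_psi a x y : 0 < a -> 0 <= x -> x < y -> psi a x < psi a y.
Proof.
move=> a0 x0 xy; rewrite /psi.
have hx := hyp_ge0 a x; have hy := hyp_ge0 a y.
rewrite ltr_pdivrMr ?ltr_wpDl // mulrAC ltr_pdivlMr ?ltr_wpDl //.
have le : x * hyp a y <= y * hyp a x.
  rewrite -(@ler_pXn2r _ 2%N) ?nnegrE ?mulr_ge0 //; last lra.
  rewrite !exprMn !sqr_hyp.
  have : x ^+ 2 <= y ^+ 2 by rewrite lerXn2r ?nnegrE //; lra.
  have := sqr_ge0 a; nra.
nra.
Qed.

(** The denominator of [psi a y] is lowered to that of [psi a 1], which is at least [2 * a]. *)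
Lemma psi_slope a y : 0 < a -> 1 <= y -> psi a y - psi a 1 <= (y - 1) / (2 * a).
Proof.
move=> a0 y1; rewrite /psi.
have a1 : a <= hyp a 1 by rewrite -{1}(hyp0 (ltW a0)) ler_hyp // ltW.
have hy : hyp a 1 <= hyp a y by rewrite ler_hyp // ltW.
have le : y / (hyp a y + a) <= y / (hyp a 1 + a).
  rewrite ler_wpM2l //; first lra.
  rewrite lef_pV2 ?posrE; lra.
apply: (@le_trans _ _ ((y - 1) / (hyp a 1 + a))).
  by rewrite mulrBl lerD2r.
rewrite ler_wpM2l //; first lra.
rewrite lef_pV2 ?posrE; lra.
Qed.

(** The share of one edge of F in SO_red, for [a] = n - 2 and end degrees [x], [y] in F. *)
Definition edge_weight a x y := psi a x + psi a y + hyp x y.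

Lemma edge_weightC a x y : edge_weight a x y = edge_weight a y x.
Proof. by rewrite /edge_weight hypC (addrC (psi a x)). Qed.

(** Write x for [t + 1 - y]. Passing from degrees x, y to t, 1 costs at most [(y - 1) / (2 * a)] in
    [psi], by [psi_slope]. The squared norms differ by 2(x - 1)(y - 1) and both norms are below
    [2 * a], so [hyp] gains more than that. *)
Lemma edge_weight_lt_star a t y : 2 <= y -> y <= t + 1 - y -> t <= a ->
  edge_weight a (t + 1 - y) y < edge_weight a t 1.
Proof.
move=> y2; set x := t + 1 - y => yx ta; rewrite /edge_weight.
have a0 : 0 < a by rewrite /x in yx; lra.
have le1 : psi a x <= psi a t.
  by have [->//|ne] := eqVneq x t; apply/ltW/ltr_psi => //; rewrite /x in yx *; lra.
have y1 : 1 <= y by lra.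
have le2 := psi_slope a0 y1.
have hx := hyp_ge0 x y; have ht := hyp_ge0 t 1.
have Ex := sqr_hyp x y; have Et := sqr_hyp t 1.
have D : (hyp t 1 - hyp x y) * (hyp t 1 + hyp x y) = 2 * (x - 1) * (y - 1).
  by rewrite -subr_sqr Ex Et /x; ring.
have ht2 : hyp t 1 < 2 * a.
  rewrite -(@ltr_pXn2r _ 2%N) ?nnegrE //; last lra.
  rewrite Et; rewrite /x in yx; nra.
have lt : hyp x y <= hyp t 1.
  rewrite leNgt; apply/negP => c; have : 0 < (x - 1) * (y - 1) by apply: mulr_gt0; lra.
  nra.
have lt3 : (y - 1) / (2 * a) < hyp t 1 - hyp x y.
  rewrite ltr_pdivrMr; last lra.
  have lt4 : hyp t 1 + hyp x y < 2 * (2 * a) by lra.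
  have p0 : 0 <= hyp t 1 - hyp x y by lra.
  have : y - 1 <= (x - 1) * (y - 1) by nra.
  have [z|nz] := eqVneq (hyp t 1 - hyp x y) 0.
    have : 0 < (x - 1) * (y - 1) by apply: mulr_gt0; lra.
    move: D; rewrite z mul0r; lra.
  have p1 : 0 < hyp t 1 - hyp x y by rewrite lt_def nz.
  have : (hyp t 1 - hyp x y) * (hyp t 1 + hyp x y) < (hyp t 1 - hyp x y) * (2 * (2 * a)).
    by rewrite ltr_pM2l.
  rewrite D; lra.
lra.
Qed.

(** Let y be the smaller degree. If the sum is below [t + 1], raising x to [t + 1 - y] strictly
    increases the weight; on the line of sum [t + 1], [edge_weight_lt_star] settles everything but
    [y = 1], where x = t. *)
Lemma edge_weight_le_star a (t x y : nat) :
    (0 < x)%N -> (0 < y)%N -> (x + y <= t.+1)%N -> t%:R <= a ->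
  [\/ x = t /\ y = 1%N, x = 1%N /\ y = t |
      edge_weight a x%:R y%:R < edge_weight a t%:R 1].
Proof.
wlog yx : x y / (y <= x)%N => [hw|] x0 y0 xyt ta.
  case/orP: (leq_total y x) => [/hw|/hw h]; first exact.
  case: (h y0 x0 _ ta) => [|[-> ->]|[-> ->]|]; rewrite 1?addnC //.
  - by constructor 2.
  - by constructor 1.
  - by rewrite edge_weightC; constructor 3.
have [E|ne] := eqVneq (x + y)%N t.+1; last first.
  constructor 3; have lt : (x + y <= t)%N by rewrite -ltnS ltn_neqAle ne.
  have a0 : 0 < a by apply: lt_le_trans ta; rewrite ltr0n;
    apply: leq_trans lt; rewrite addn_gt0 x0.
  have xr : (x%:R : R) < t%:R + 1 - y%:R.
    by rewrite ltrBrDr -natrD natr1 ltr_nat.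
  have xr0 : 0 <= x%:R :> R by [].
  have yr0 : 0 <= y%:R :> R by [].
  have lt1 : edge_weight a x%:R y%:R < edge_weight a (t%:R + 1 - y%:R) y%:R.
    have := ltr_psi a0 xr0 xr.
    have := ler_hyp xr0 (ltW xr) yr0 (lexx _).
    rewrite /edge_weight; lra.
  apply: lt_le_trans lt1 _.
  have [y1|y1] := eqVneq y 1%N; first by rewrite y1 addrK.
  apply/ltW/edge_weight_lt_star => //.
    by rewrite ler_nat ltn_neqAle eq_sym y1.
  by apply: le_trans (ltW xr); rewrite ler_nat.
have [y1|y1] := eqVneq y 1%N.
  by constructor 1; move: E; rewrite y1 addn1 => -[->].
constructor 3.
have xE : x%:R = t%:R + 1 - y%:R :> R by rewrite natr1 -E natrD addrK.
rewrite xE; apply: edge_weight_lt_star => //.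
  by rewrite ler_nat ltn_neqAle eq_sym y1.
by rewrite -xE ler_nat.
Qed.

End RealInequalities.

(** * Edges, degrees and double counting *)

Section DoubleCounting.
Variable G : sgraph.
Implicit Types (x y z : G).

Lemma adj_neq x y : adj x y -> x != y.
Proof. by case: eqP => // ->; rewrite adj_irrefl. Qed.

Lemma in_edges x y : ([set x; y] \in edges G) = adj x y.
Proof.
apply/imsetP/idP => [[[a b] /=]|xy]; last by exists (x, y); rewrite ?inE.
rewrite inE /= => ab E.
have : x \in [set a; b] by rewrite -E set21.
have : y \in [set a; b] by rewrite -E set22.
have : a \in [set x; y] by rewrite E set21.
have : b \in [set x; y] by rewrite E set22.
rewrite !inE => /orP[]/eqP bE /orP[]/eqP aE; subst a b => //.
- by rewrite adj_irrefl in ab.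
- by rewrite adj_sym.
- by rewrite adj_irrefl in ab.
Qed.

Lemma edgesP (e : {set G}) :
  reflect (exists x y, adj x y /\ e = [set x; y]) (e \in edges G).
Proof.
apply: (iffP imsetP) => [[[a b]]|[x [y [xy ->]]]]; last by exists (x, y); rewrite ?inE.
by rewrite inE /= => ab ->; exists a, b.
Qed.

Lemma set2_inj x y z t : [set x; y] = [set z; t] ->
  (x = z /\ y = t) \/ (x = t /\ y = z).
Proof.
move=> E.
have : x \in [set z; t] by rewrite -E set21.
have : y \in [set z; t] by rewrite -E set22.
have : z \in [set x; y] by rewrite E set21.
have : t \in [set x; y] by rewrite E set22.
rewrite !inE; do 4![case/orP=> /eqP ?]; subst; by [left|right].
Qed.

(** Each edge is the image of exactly two ordered pairs of adjacent vertices. Later comparisons of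
    indices are therefore made between doubled sums. *)
Lemma sum_edges2 (V : nmodType) (F : {set G} -> V) :
  (\sum_(e in edges G) F e) *+ 2 = \sum_(x : G) \sum_(y | adj x y) F [set x; y].
Proof.
rewrite pair_big_dep /=.
rewrite (partition_big (fun p : G * G => [set p.1; p.2]) (mem (edges G))) /=; last first.
  by move=> p; rewrite in_edges.
rewrite -sumrMnl; apply: eq_bigr => e /edgesP[x [y [xy ->]]].
have ne := adj_neq xy.
rewrite (bigD1 (x, y)) /=; last by rewrite xy eqxx.
rewrite (bigD1 (y, x)) /=; last first.
  by rewrite adj_sym xy setUC eqxx xpair_eqE eq_sym (negbTE ne).
rewrite big1 ?addr0; first by rewrite [[set y; x]]setUC mulr2n.
case=> a b /= /andP[/andP[/andP[_ /eqP/set2_inj]]].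
by case=> -[-> ->]; rewrite eqxx.
Qed.

Lemma degE x : deg x = (\sum_(y | adj x y) 1)%N.
Proof. by rewrite sum1_card /deg cardsE. Qed.

Lemma handshake : (#|edges G| * 2 = \sum_(x : G) deg x)%N.
Proof.
rewrite -sum1_card muln2 -addnn.
have E := @sum_edges2 nat (fun=> 1%N); rewrite mulr2n in E; apply: (etrans E).
by apply: eq_bigr => x _; rewrite degE.
Qed.

Lemma SOred2 (R : realType) : SOred R G *+ 2 =
  \sum_(x : G) \sum_(y | adj x y) hyp ((deg x)%:R - 1) ((deg y)%:R - 1).
Proof.
rewrite /SOred sum_edges2; apply: eq_bigr => x _; apply: eq_bigr => y xy.
by rewrite big_setU1 ?inE ?(adj_neq xy) //= big_set1.
Qed.

Lemma sum_deg (R : pzRingType) (g : G -> R) :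
  \sum_(x : G) \sum_(y | adj x y) g x = \sum_(x : G) (deg x)%:R * g x.
Proof.
by apply: eq_bigr => x _; rewrite sumr_const mulr_natl /deg cardsE.
Qed.

Lemma exchange_adj (V : nmodType) (g : G -> G -> V) :
  \sum_(x : G) \sum_(y | adj x y) g x y = \sum_(x : G) \sum_(y | adj x y) g y x.
Proof.
rewrite (exchange_big_dep xpredT) //=.
by apply: eq_bigr => x _; apply: eq_bigl => y; rewrite adj_sym.
Qed.

Definition edges_at x := [set [set x; y] | y in [set y | adj x y]].

Lemma edges_at_sub x : edges_at x \subset edges G.
Proof. by apply/subsetP => e /imsetP[y]; rewrite inE => xy ->; rewrite in_edges. Qed.

Lemma card_edges_at x : #|edges_at x| = deg x.
Proof.
rewrite card_imset //.
by move=> y z /set2_inj[[_ //]|[-> ->]].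
Qed.

Lemma in_edges_at x y z : adj y z -> ([set y; z] \in edges_at x) = (x == y) || (x == z).
Proof.
move=> yz; apply/imsetP/idP => [[t _ /set2_inj[[<- _]|[_ <-]]]|].
- by rewrite eqxx.
- by rewrite eqxx orbT.
case/orP=> /eqP->; first by exists z; rewrite ?inE.
by exists y; rewrite ?inE 1?adj_sym // setUC.
Qed.

(** The edges at [x] and the edges at [y] have only the edge xy in common. *)
Lemma deg_sum_edge x y : adj x y -> (deg x + deg y <= #|edges G|.+1)%N.
Proof.
move=> xy; rewrite -!card_edges_at -cardsUI -addn1 leq_add //.
  by apply: subset_leq_card; rewrite subUset !edges_at_sub.
rewrite -(cards1 [set x; y]); apply/subset_leq_card/subsetP => e.
rewrite !inE => /andP[/imsetP[z zx ->]]; rewrite inE in zx.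
rewrite in_edges_at // => /orP[]/eqP yE; subst; last by [].
by rewrite adj_irrefl in xy.
Qed.

Lemma deg_ltn x : (deg x < #|G|)%N.
Proof.
rewrite /deg -cardsT; apply: proper_card; apply/properP; split=> //.
by exists x; rewrite ?inE // adj_irrefl.
Qed.

Lemma deg_gt0 x y : adj x y -> (0 < deg x)%N.
Proof. by move=> xy; apply/card_gt0P; exists y; rewrite inE. Qed.

End DoubleCounting.

(** Extended by 0 to non-adjacent pairs, so that two graphs on the same vertices can be compared
    term by term. *)
Definition edge_term (R : realType) (K : sgraph) (x y : K) : R :=
  if adj x y then hyp ((deg x)%:R - 1) ((deg y)%:R - 1) else 0.

Lemma edge_termC R K x y : @edge_term R K x y = edge_term R y x.
Proof. by rewrite /edge_term adj_sym hypC. Qed.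

Lemma edge_term_diag R K x : @edge_term R K x x = 0.
Proof. by rewrite /edge_term adj_irrefl. Qed.

Lemma SOred_edge_term R K : SOred R K *+ 2 = \sum_x \sum_y @edge_term R K x y.
Proof. by rewrite SOred2; apply: eq_bigr => x _; rewrite big_mkcond. Qed.

(** * Kelmans' move from [w] to [u] *)

Section Kelmans.
Variables (G : sgraph) (u w : G).
Hypothesis uw : adj u w.

Definition private_nbrs : {set G} := [set x | [&& adj w x, ~~ adj u x & x != u]].
Local Notation P := private_nbrs.

Definition kelmans_adj : rel G := fun x y =>
  [|| [&& adj x y, ~~ ((x == w) && (y \in P)) & ~~ ((y == w) && (x \in P))],
      (x == u) && (y \in P) | (y == u) && (x \in P)].

Lemma kelmans_sym : symmetric kelmans_adj.
Proof.
move=> x y; rewrite /kelmans_adj adj_sym.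
by congr (_ || _); [congr (_ && _); exact: andbC|exact: orbC].
Qed.

Lemma kelmans_irrefl : irreflexive kelmans_adj.
Proof.
move=> x; rewrite /kelmans_adj adj_irrefl /= orbb.
by apply/negP => /andP[/eqP->]; rewrite inE eqxx !andbF.
Qed.

Definition kelmans : sgraph := SGraph kelmans_sym kelmans_irrefl.

Lemma kelmansE (x y : G) : adj (x : kelmans) y = kelmans_adj x y.
Proof. by []. Qed.

Let une : u != w := adj_neq uw.
Let uNP : u \notin P. Proof. by rewrite inE eqxx !andbF. Qed.
Let wNP : w \notin P. Proof. by rewrite inE adj_irrefl. Qed.

Lemma kelmans_adj_out x y : x \notin [set u; w] -> y \notin [set u; w] ->
  kelmans_adj x y = adj x y.
Proof.
rewrite !inE !negb_or /kelmans_adj => /andP[/negbTE-> /negbTE->] /andP[/negbTE-> /negbTE->].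
by rewrite /= !andbT orbF.
Qed.

Lemma kelmans_adj_uw : kelmans_adj u w.
Proof. by rewrite /kelmans_adj uw (negbTE uNP) (negbTE wNP) !andbF. Qed.

Lemma kelmans_adj_u y : y \notin [set u; w] ->
  kelmans_adj u y = adj u y || adj w y.
Proof.
rewrite !inE !negb_or /kelmans_adj => /andP[yu yw].
rewrite eqxx (negbTE une) (negbTE yw) (negbTE yu) !inE yu /= !andbT orbF.
by case: (adj u y); case: (adj w y).
Qed.

Lemma kelmans_adj_w y : y \notin [set u; w] ->
  kelmans_adj w y = adj u y && adj w y.
Proof.
rewrite !inE !negb_or /kelmans_adj => /andP[yu yw].
rewrite eqxx [w == u]eq_sym (negbTE une) (negbTE yw) (negbTE yu) !inE yu /= !andbT !orbF.
by case: (adj u y); case: (adj w y).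
Qed.

Lemma kelmans_nbrs_u : [set y : kelmans | adj (u : kelmans) y] = [set y | adj u y] :|: P.
Proof.
apply/setP => y; rewrite !inE kelmansE.
have [->|yu] := eqVneq y u.
  by rewrite kelmans_irrefl adj_irrefl !andbF.
have [->|yw] := eqVneq y w; first by rewrite kelmans_adj_uw uw.
rewrite kelmans_adj_u ?inE ?negb_or ?yu //= ?andbT.
by case: (adj u y); case: (adj w y).
Qed.

Lemma kelmans_nbrs_w : [set y : kelmans | adj (w : kelmans) y] = [set y | adj w y] :\: P.
Proof.
apply/setP => y; rewrite !inE kelmansE.
have [->|yu] := eqVneq y u.
  by rewrite kelmans_sym kelmans_adj_uw adj_sym uw !andbF.
have [->|yw] := eqVneq y w; first by rewrite kelmans_irrefl adj_irrefl andbF.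
rewrite kelmans_adj_w ?inE ?negb_or ?yu //= ?andbT.
by case: (adj u y); case: (adj w y).
Qed.

Lemma kelmans_deg_u : deg (u : kelmans) = (deg u + #|P|)%N.
Proof.
rewrite /deg kelmans_nbrs_u cardsU -[RHS]subn0; congr (_ - _)%N.
apply/eqP; rewrite cards_eq0 -subset0; apply/subsetP => y.
by rewrite !inE; case: (adj u y); rewrite ?andbF.
Qed.

Lemma private_sub_nbrs : P \subset [set y | adj w y].
Proof. by apply/subsetP => y; rewrite !inE => /and3P[]. Qed.

Lemma kelmans_deg_w : deg (w : kelmans) = (deg w - #|P|)%N.
Proof.
rewrite /deg kelmans_nbrs_w cardsD; congr (_ - #|pred_of_set _|)%N.
exact/setIidPr/private_sub_nbrs.
Qed.

(** The vertex [u] is a neighbour of [w] that is not moved. This gives the bound [b <= q] under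
    which [hyp_spread] applies. *)
Lemma private_lt_deg : (#|P| < deg w)%N.
Proof.
apply: proper_card; apply/properP; split; first exact: private_sub_nbrs.
by exists u; rewrite ?inE 1?adj_sym // eqxx !andbF.
Qed.

(** A vertex of [P] trades its neighbour [w] for [u]; any other outside vertex keeps its
    neighbourhood. *)
Lemma kelmans_deg_out x : x \notin [set u; w] -> deg (x : kelmans) = deg x.
Proof.
move=> xS; rewrite /deg.
have [xP|xP] := boolP (x \in P).
  have -> : [set y : kelmans | adj (x : kelmans) y] = u |: ([set y | adj x y] :\ w).
    apply/setP => y; rewrite !inE kelmansE.
    have [->|yu] := eqVneq y u.
      by rewrite kelmans_sym kelmans_adj_u //=; move: xP;
        rewrite inE => /and3P[-> _ _]; rewrite orbT.
    have [->|yw] := eqVneq y w.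
      by rewrite kelmans_sym kelmans_adj_w //=; move: xP; rewrite inE => /and3P[_ /negbTE-> _].
    by rewrite kelmans_adj_out // !inE negb_or yu.
  rewrite cardsU1 !inE une /= adj_sym.
  move: (xP); rewrite inE => /and3P[wx /negbTE-> xu].
  by rewrite [RHS](cardsD1 w) inE adj_sym wx.
apply: eq_card => y; rewrite !inE kelmansE.
have [->|yu] := eqVneq y u.
  rewrite kelmans_sym kelmans_adj_u // [in RHS]adj_sym.
  move: xP xS; rewrite !inE negb_or => xP /andP[xu _]; move: xP; rewrite xu andbT.
  by case: (adj u x); case: (adj w x).
have [->|yw] := eqVneq y w.
  rewrite kelmans_sym kelmans_adj_w // [in RHS]adj_sym.
  move: xP xS; rewrite !inE negb_or => xP /andP[xu _]; move: xP; rewrite xu andbT.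
  by case: (adj u x); case: (adj w x).
by rewrite kelmans_adj_out // !inE negb_or yu.
Qed.

(** The edge uw survives the move, so a lost edge wz is replaced by the path w, u, z, and a new edge
    uz comes from the path u, w, z. *)
Lemma connect_kelmans : connect (@adj G) =2 connect kelmans_adj.
Proof.
have symG : connect_sym (@adj G) := sym_connect_sym (@adj_sym G).
have symK : connect_sym kelmans_adj := sym_connect_sym kelmans_sym.
have GK x y : adj x y -> connect kelmans_adj x y.
  wlog xS : x y / x \notin [set u; w] => [hw xy|].
    have [xS|xS] := boolP (x \notin [set u; w]); first exact: hw.
    have [yS|yS] := boolP (y \notin [set u; w]); first by rewrite symK hw // adj_sym.
    move: xS yS xy; rewrite !inE !negbK.
    case/orP=> /eqP-> /orP[]/eqP->; rewrite ?adj_irrefl // => _; last rewrite symK;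
      exact/connect1/kelmans_adj_uw.
  have [->|yu] := eqVneq y u => xy.
    by rewrite symK; apply: connect1; rewrite kelmans_adj_u // adj_sym xy.
  move: xy; have [->|yw] := eqVneq y w => xy.
    apply: (@connect_trans _ _ u); last exact/connect1/kelmans_adj_uw.
    by rewrite symK; apply: connect1; rewrite kelmans_adj_u // [adj w x]adj_sym xy orbT.
  by apply: connect1; rewrite kelmans_adj_out // !inE negb_or yu.
have KG x y : kelmans_adj x y -> connect (@adj G) x y.
  have uP z : z \in P -> connect (@adj G) u z.
    by rewrite inE => /and3P[wz _ _]; apply: connect_trans (connect1 uw) (connect1 wz).
  case/or3P=> [/and3P[xy _ _]|/andP[/eqP-> /uP//]|/andP[/eqP-> /uP]].
    exact: connect1.
  by rewrite symG.
by move=> x y; apply/idP/idP; apply: connect_sub => a b; [exact: GK|exact: KG].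
Qed.

Lemma components_kelmans : components kelmans = components G.
Proof.
by rewrite /components; apply: eq_n_comp => x y; rewrite connect_kelmans.
Qed.

Lemma sum_split2 (V : nmodType) (F : G -> V) :
  \sum_x F x = (F u + F w) + \sum_(x | x \notin [set u; w]) F x.
Proof.
rewrite (bigID (mem [set u; w])) /= big_setU1 ?inE //= big_set1.
by congr (_ + _).
Qed.

(** Grouping the terms of [u] and [w] by their outer end [y] is what lets convexity be applied for
    each [y] separately. *)
Lemma sum_pairs_split (V : comPzRingType) (h : G -> G -> V) :
    (forall x y, h x y = h y x) -> (forall x, h x x = 0) ->
  \sum_x \sum_y h x y =
    \sum_(x | x \notin [set u; w]) \sum_(y | y \notin [set u; w]) h x y +
    (\sum_(y | y \notin [set u; w]) (h u y + h w y) + h u w) *+ 2.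
Proof.
move=> hC h0.
rewrite sum_split2 !sum_split2 !h0 [h w u]hC.
under [X in _ + X = _]eq_bigr => x _ do rewrite sum_split2 [h x u]hC [h x w]hC.
rewrite !big_split /=; ring.
Qed.

Lemma card_edges_kelmans : #|edges kelmans| = #|edges G|.
Proof.
apply/eqP; rewrite -(@eqn_pmul2r 2) // !handshake; apply/eqP.
rewrite [LHS]sum_split2 [RHS]sum_split2; congr (_ + _)%N; last first.
  by apply: eq_bigr => x /kelmans_deg_out.
have := private_lt_deg; rewrite kelmans_deg_u kelmans_deg_w; lia.
Qed.

Lemma cyclomatic_kelmans : cyclomatic kelmans = cyclomatic G.
Proof. by rewrite /cyclomatic components_kelmans card_edges_kelmans. Qed.

(** Pairs outside [u], [w] keep their terms. For each outer [y] the two terms do not decrease in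
    sum: by convexity if [y] is a common neighbour, by monotonicity if it is adjacent to only one.
    The strict gain comes from the edge uw. *)
Lemma SOred_kelmans (R : realType) :
  (deg w <= deg u)%N -> P != set0 -> SOred R G < SOred R kelmans.
Proof.
move=> wu P0; rewrite -(@ltr_pMn2r _ 2) // !SOred_edge_term.
rewrite (sum_pairs_split (@edge_termC R G) (@edge_term_diag R G)).
rewrite [ltRHS](sum_pairs_split (@edge_termC R kelmans) (@edge_term_diag R kelmans)).
set p : R := (deg u)%:R - 1; set q : R := (deg w)%:R - 1; set b : R := #|P|%:R.
have pE : (deg (u : kelmans))%:R - 1 = p + b by rewrite kelmans_deg_u natrD /p /b; ring.
have qE : (deg (w : kelmans))%:R - 1 = q - b.
  by rewrite kelmans_deg_w natrB ?(ltnW private_lt_deg) // /q /b; ring.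
have b1 : 1 <= b by rewrite /b ler1n card_gt0.
have bq : b <= q by rewrite /b /q lerBrDr natr1 ler_nat private_lt_deg.
have qp : q <= p by rewrite lerB // ler_nat.
have eq_out : \sum_(x | x \notin [set u; w]) \sum_(y | y \notin [set u; w]) edge_term R x y
   = \sum_(x | x \notin [set u; w]) \sum_(y | y \notin [set u; w]) edge_term R (x : kelmans) y.
  apply: eq_bigr => x xS; apply: eq_bigr => y yS.
  by rewrite /edge_term kelmansE kelmans_adj_out // !kelmans_deg_out.
rewrite eq_out ltrD2l ltr_pMn2r //; apply: ler_ltD; last first.
  rewrite /edge_term uw kelmansE kelmans_adj_uw pE qE -/p -/q.
  have b0 : 0 < b by lra.
  have pq : 0 <= p - q by lra.
  have := mulr_ge0 (ltW b0) pq; have := mulr_gt0 b0 b0 => ? ?.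
  apply: hyp_lt_sqr; nra.
apply: ler_sum => y yS.
rewrite /edge_term !kelmansE kelmans_adj_u // kelmans_adj_w // pE qE.
rewrite !kelmans_deg_out // -/p -/q.
have [yu|yu] := boolP (adj u y); have [yw|yw] := boolP (adj w y) => //=.
- by apply: hyp_spread => //; lra.
- rewrite !addr0; have : 0 <= (deg y)%:R - 1 :> R.
    by rewrite subr_ge0 ler1n (@deg_gt0 _ _ u) // adj_sym.
  by move=> ?; apply: ler_hyp => //; lra.
- rewrite !addr0 add0r; have : 0 <= (deg y)%:R - 1 :> R.
    by rewrite subr_ge0 ler1n (@deg_gt0 _ _ w) // adj_sym.
  by move=> ?; apply: ler_hyp => //; lra.
Qed.

End Kelmans.

(** * Joining two components by an edge *)

Section JoinComponents.
Variables (G : sgraph) (u v : G).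
Hypothesis uv : ~~ connect (@adj G) u v.

Definition bridge_adj : rel G := fun x y =>
  adj x y || ([set x; y] == [set u; v]).

Lemma bridge_sym : symmetric bridge_adj.
Proof. by move=> x y; rewrite /bridge_adj adj_sym setUC. Qed.

Let bridge_neq : u != v.
Proof. by apply: contraNneq uv => ->; rewrite connect0. Qed.

Lemma bridge_irrefl : irreflexive bridge_adj.
Proof.
move=> x; rewrite /bridge_adj adj_irrefl /=; apply/negbTE/eqP => /set2_inj E.
by case: E bridge_neq => -[<- <-]; rewrite eqxx.
Qed.

Definition bridge : sgraph := SGraph bridge_sym bridge_irrefl.

Lemma bridgeE (x y : G) : adj (x : bridge) y = bridge_adj x y.
Proof. by []. Qed.

Lemma edges_bridge : edges bridge = [set u; v] |: edges G.
Proof.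
apply/setP => e; rewrite !inE; apply/edgesP/orP => [[x [y [+ ->]]]|].
  rewrite bridgeE => /orP[xy|/eqP->]; first by right; rewrite in_edges.
  by left.
case=> [/eqP->|/edgesP[x [y [xy ->]]]]; first by
  exists u, v; rewrite bridgeE /bridge_adj eqxx orbT.
by exists x, y; rewrite bridgeE /bridge_adj xy.
Qed.

Lemma card_edges_bridge : #|edges bridge| = #|edges G|.+1.
Proof.
have h : [set u; v] \notin edges G by rewrite in_edges (contra (@connect1 _ _ _ _) uv).
by rewrite edges_bridge cardsU1 h.
Qed.

(** Split the count along [a], the union of the components of [u] and [v]: inside, two components
    become one; outside, connectivity is unchanged. *)
Lemma components_bridge : components G = (components bridge).+1.
Proof.
have symG : connect_sym (@adj G) := sym_connect_sym (@adj_sym G).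
have symJ : connect_sym bridge_adj := sym_connect_sym bridge_sym.
have sub x y : connect (@adj G) x y -> connect bridge_adj x y.
  by apply: connect_sub => a b ab; apply: connect1; rewrite /bridge_adj ab.
pose a : pred G := closure (@adj G) (pred2 u v).
have aE x : (x \in a) = connect (@adj G) x u || connect (@adj G) x v.
  apply/idP/orP.
    by case/pred0Pn => z /= /andP[xz /orP[]/eqP E]; subst; [left|right].
  by case=> xz; apply/existsP; [exists u|exists v]; rewrite !inE xz eqxx ?orbT.
have clG : closed (@adj G) a := closure_closed symG _.
have clJ : closed bridge_adj a.
  apply: (intro_closed symJ) => x y /orP[xy|/eqP/set2_inj]; first by rewrite (clG x y xy).
  by case=> -[-> ->]; rewrite !aE !connect0 ?orbT.
have nT e : n_comp e [set: G] = n_comp e G by apply: eq_n_comp_r => x; rewrite inE.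
rewrite /components !nT (n_compC a (@adj G)) (n_compC a bridge_adj) -addSn; congr (_ + _)%N.
  rewrite n_comp_closure2 // uv.
  have aJ : a =i closure bridge_adj (pred2 u v).
    move=> x; apply/idP/idP.
      by rewrite aE => /orP[]/sub xz; apply/existsP;
        [exists u|exists v]; rewrite !inE xz eqxx ?orbT.
    case/pred0Pn => z /= /andP[xz zuv]; rewrite (closed_connect clJ xz) aE.
    by case/orP: zuv => /eqP->; rewrite connect0 ?orbT.
  rewrite (eq_n_comp_r aJ) n_comp_closure2 // (connect1 (_ : bridge_adj u v)) //.
  by rewrite /bridge_adj eqxx orbT.
(* A walk of the new graph that starts outside the closed set [a] never meets the new edge. *)
have eqC x : x \notin a -> connect (@adj G) x =1 connect bridge_adj x.
  move=> xa y; apply/idP/idP => [/sub//|/connectP[p xp ->]].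
  elim: p x xa xp => //= y' p IH x xa /andP[xy yp].
  have xyG : adj x y'.
    case/orP: xy => // /eqP/set2_inj E; move: xa; rewrite aE negb_or.
    by case: E => -[-> _]; rewrite connect0 ?andbF.
  by apply: connect_trans (connect1 xyG) (IH _ _ yp); rewrite -(clG _ _ xyG).
rewrite /n_comp_mem; apply: eq_card => x; rewrite !inE; apply: andb_id2r => xa.
(* The chosen root of a class depends only on the class. *)
have E : fingraph.root (@adj G) x = fingraph.root bridge_adj x
  by congr odflt; apply: eq_pick; apply: eqC.
by rewrite /roots /= E.
Qed.

Lemma cyclomatic_bridge : cyclomatic bridge = cyclomatic G.
Proof.
rewrite /cyclomatic card_edges_bridge components_bridge.
have -> : #|bridge| = #|G| by [].
lia.
Qed.

Lemma deg_bridge (x : G) : (deg x <= deg (x : bridge))%N.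
Proof.
by apply: subset_leq_card; apply/subsetP => y; rewrite !inE bridgeE /bridge_adj => ->.
Qed.

Lemma deg_bridge_u : (deg u < deg (u : bridge))%N.
Proof.
apply: proper_card; apply/properP; split.
  by apply/subsetP => y; rewrite !inE bridgeE /bridge_adj => ->.
exists v; rewrite !inE ?bridgeE ?/bridge_adj ?eqxx ?orbT //.
exact: contra (@connect1 _ _ _ _) uv.
Qed.

(** Degrees only grow, so no term decreases. The new degree of [u] is at least 2, which makes the
    term of the new edge positive; between two isolated vertices it would be 0. *)
Lemma SOred_bridge (R : realType) : (0 < deg u)%N -> SOred R G < SOred R bridge.
Proof.
move=> u0; rewrite -(@ltr_pMn2r _ 2) // !SOred_edge_term.
have le (x y : G) : edge_term R x y <= edge_term R (x : bridge) y.
  rewrite /edge_term bridgeE /bridge_adj; have [xy|xy] /= := boolP (adj x y); last first.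
    by case: ifP => // _; apply: hyp_ge0.
  have x0 := deg_gt0 xy; rewrite adj_sym in xy; have y0 := deg_gt0 xy.
  by apply: ler_hyp; rewrite ?lerD2r ?subr_ge0 ?ler_nat ?ler1n ?deg_bridge.
rewrite (bigD1 u) //= [ltRHS](bigD1 u) //=; apply: ltr_leD; last first.
  by apply: ler_sum => x _; apply: ler_sum.
rewrite (bigD1 v) //= [ltRHS](bigD1 v) //=; apply: ltr_leD; last by apply: ler_sum.
rewrite /edge_term bridgeE /bridge_adj eqxx orbT (negbTE (contra (@connect1 _ _ _ _) uv)).
rewrite -[ltLHS](sqrtr0 R) /hyp ltr_sqrt.
  apply: ltr_wpDr; first exact: sqr_ge0.
  by rewrite exprn_gt0 // subr_gt0 ltr1n (leq_ltn_trans u0 deg_bridge_u).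
apply: ltr_wpDr; first exact: sqr_ge0.
by rewrite exprn_gt0 // subr_gt0 ltr1n (leq_ltn_trans u0 deg_bridge_u).
Qed.

End JoinComponents.

Definition SO_bound (R : realType) (n nu : nat) : R :=
    (n%:R - nu%:R - 2) * (n%:R - 2)
    + nu%:R * Num.sqrt ((n%:R - 2) ^+ 2 + 1)
    + nu%:R * Num.sqrt (nu%:R ^+ 2 + 1)
    + Num.sqrt ((n%:R - 2) ^+ 2 + nu%:R ^+ 2).

(** By [psiE] the closed formula takes the shape of the overview: n - 1 spokes of base value [a],
    and the star weight on each of [nu] edges. *)
Lemma SO_boundE (R : realType) (n nu : nat) (a := n%:R - 2 : R) : (1 < n)%N ->
  SO_bound R n nu = (n%:R - 1) * a + nu%:R * edge_weight a nu%:R 1.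
Proof.
move=> n2; have a0 : 0 <= a by rewrite /a subr_ge0 ler_nat.
rewrite /edge_weight !mulrDr psiE // -[psi a 1]mul1r psiE //.
by rewrite /SO_bound /hyp expr1n -/a; rewrite /a; ring.
Qed.

Lemma sum_edge_const (R : realType) (K : sgraph) (k : R) :
  \sum_(x : K) \sum_(y | adj x y) k = (#|edges K|%:R * k) *+ 2.
Proof. by rewrite -(sum_edges2 (fun=> k)) sumr_const mulr_natl. Qed.

(** * Graphs with a dominating vertex *)

Section Dominating.
Variables (G : sgraph) (c : G).
Hypothesis dom : forall x, x != c -> adj c x.

(** The graph F of the overview, with [c] kept as an isolated vertex so that the vertex type does
    not change. *)
Definition isolate_adj : rel G := fun x y => [&& adj x y, x != c & y != c].

Lemma isolate_sym : symmetric isolate_adj.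
Proof. by move=> x y; rewrite /isolate_adj adj_sym [(x != c) && _]andbC. Qed.

Lemma isolate_irrefl : irreflexive isolate_adj.
Proof. by move=> x; rewrite /isolate_adj adj_irrefl. Qed.

Definition isolate : sgraph := SGraph isolate_sym isolate_irrefl.
Local Notation F := isolate.

Lemma isolateE (x y : G) : adj (x : F) y = isolate_adj x y.
Proof. by []. Qed.

Lemma adj_dom x : adj c x = (x != c).
Proof. by have [->|/dom//] := eqVneq x c; rewrite adj_irrefl. Qed.

Lemma deg_isolate_c : deg (c : F) = 0%N.
Proof.
apply/eqP; rewrite cards_eq0; apply/eqP/setP => x.
by rewrite !inE isolateE /isolate_adj eqxx andbF.
Qed.

Lemma deg_isolate x : x != c -> deg x = (deg (x : F)).+1.
Proof.
move=> xc; rewrite /deg [LHS](cardsD1 c) inE adj_sym dom // add1n; congr _.+1.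
by apply: eq_card => y; rewrite !inE isolateE /isolate_adj xc andbC.
Qed.

Lemma deg_dom : deg c = #|G|.-1.
Proof.
rewrite -cardsT (cardsD1 c) inE /= /deg; apply: eq_card => x.
by rewrite !inE adj_dom andbT.
Qed.

Lemma card_gt0_dom : (0 < #|G|)%N.
Proof. by apply/card_gt0P; exists c. Qed.

Lemma card_edges_dom : (#|edges G| = #|G|.-1 + #|edges F|)%N.
Proof.
apply/eqP; rewrite -(@eqn_pmul2r 2) // mulnDl !handshake; apply/eqP.
rewrite (bigD1 c) //= [in RHS](bigD1 c) //= deg_isolate_c deg_dom.
rewrite (eq_bigr (fun x : G => (deg (x : F) + 1)%N)); last first.
  by move=> x xc; rewrite deg_isolate // addn1.
by rewrite big_split /= sum1_card cardC1 add0n muln2 -addnn -addnA;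
  congr (_ + _)%N; rewrite addnC.
Qed.

Lemma components_dom : components G = 1%N.
Proof.
have sym : connect_sym (@adj G) := sym_connect_sym (@adj_sym G).
rewrite /components -[RHS](n_comp_connect sym c); apply: eq_n_comp_r => x.
rewrite inE; apply/esym; have [->|xc] := eqVneq x c; first exact: connect0.
exact/connect1/dom.
Qed.

Lemma cyclomatic_dom : cyclomatic G = #|edges F|%:Z.
Proof.
rewrite /cyclomatic components_dom card_edges_dom.
have := card_gt0_dom; lia.
Qed.

(** The shift by 1 fits exactly: [deg c - 1] is [a], and for any other vertex the degree minus 1 is
    its degree in F. The doubled sum counts every spoke twice. *)
Lemma SOred_dom (R : realType) (a := #|G|%:R - 2 : R) : (1 < #|G|)%N ->
  SOred R G *+ 2 = ((#|G|%:R - 1) * a) *+ 2 +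
    \sum_(x : F) \sum_(y | adj x y) edge_weight a (deg x)%:R (deg y)%:R.
Proof.
move=> n2.
have a0 : 0 <= a by rewrite /a subr_ge0 ler_nat.
have nE : #|G|.-1%:R = #|G|%:R - 1 :> R by rewrite -subn1 natrB // ltnW.
have degc : (deg c)%:R - 1 = a by rewrite deg_dom nE /a; ring.
have degx x : x != c -> (deg x)%:R - 1 = (deg (x : F))%:R :> R.
  by move=> xc; rewrite deg_isolate // -natr1 addrK.
have spokes : \sum_(x | x != c) hyp a (deg (x : F))%:R =
    (#|G|%:R - 1) * a + \sum_(x : F) \sum_(y | adj x y) psi a (deg x)%:R.
  rewrite sum_deg [in RHS](bigD1 (c : F)) //= deg_isolate_c mul0r add0r.
  rewrite -nE mulr_natl -(cardC1 c) -sumr_const -big_split /=.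
  by apply: eq_bigr => x _; rewrite psiE // addrC subrK.
rewrite SOred2 (bigD1 c) //=.
rewrite (eq_bigl (fun y => y != c)); last by move=> y; rewrite adj_dom.
rewrite (eq_bigr (fun x : G => hyp a (deg (x : F))%:R)); last first.
  by move=> x xc; rewrite degc degx.
rewrite [X in _ + X = _](eq_bigr (fun x : G => hyp a (deg (x : F))%:R +
   \sum_(y : F | adj (x : F) y) hyp (deg (x : F))%:R (deg y)%:R)); last first.
  move=> x xc; rewrite (bigD1 c) /=; last by rewrite adj_sym dom.
  rewrite degc degx // hypC; congr (_ + _).
  rewrite (eq_bigl (fun y : G => adj (x : F) y)); last first.
    by move=> y; rewrite isolateE /isolate_adj xc.
  by apply: eq_bigr => y; rewrite isolateE => /and3P[_ _ yc]; rewrite degx.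
rewrite big_split /= addrA -mulr2n spokes mulrnDl -addrA; congr (_ + _).
have Fc (g : F -> F -> R) : \sum_(x : F) \sum_(y | adj x y) g x y =
   \sum_(x : G | x != c) \sum_(y : F | isolate_adj x y) g x y.
  rewrite (bigD1 c) //= big_pred0 ?add0r // => y.
  by rewrite /isolate_adj eqxx andbF.
(* Of the two copies of the [psi] sum, one is moved to the other end of each edge. *)
rewrite -Fc mulr2n [X in _ + X + _](exchange_adj (fun x _ => psi a (deg x)%:R)).
rewrite -!big_split /=; apply: eq_bigr => x _.
by rewrite -!big_split.
Qed.

Lemma SOred_dom_star (R : realType) :
    (1 < #|G|)%N ->
    (forall x y : F, adj x y -> deg x = #|edges F| /\ deg y = 1%N \/
                                deg x = 1%N /\ deg y = #|edges F|) ->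
  SOred R G = SO_bound R #|G| #|edges F|.
Proof.
move=> n2 star; apply: (@pmulrnI _ 2) => //.
rewrite SOred_dom // SO_boundE // mulrnDl -sum_edge_const; congr (_ + _).
apply: eq_bigr => x _; apply: eq_bigr => y /star[[-> ->]|[-> ->]] //.
by rewrite edge_weightC.
Qed.

(** By [deg_sum_edge] every edge of F satisfies the hypotheses of [edge_weight_le_star] with t the
    number of edges; a single edge not of star type would push the total strictly below the
    bound. *)
Lemma SOred_dom_bound (R : realType) :
    (#|edges F| + 2 <= #|G|)%N ->
  SO_bound R #|G| #|edges F| <= SOred R G ->
  forall x y : F, adj x y -> deg x = #|edges F| /\ deg y = 1%N \/
                                deg x = 1%N /\ deg y = #|edges F|.
Proof.
move=> nun; have n2 : (1 < #|G|)%N by lia.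
set a : R := #|G|%:R - 2; set nu := #|edges F| in nun *.
have nua : nu%:R <= a by rewrite /a lerBrDr -natrD ler_nat.
rewrite -(@ler_pMn2r _ 2) // SOred_dom // SO_boundE // mulrnDl -sum_edge_const lerD2l.
move=> le x y xy.
have cmp (z t : F) : adj z t -> [\/ deg z = nu /\ deg t = 1%N, deg z = 1%N /\ deg t = nu |
      edge_weight a (deg z)%:R (deg t)%:R < edge_weight a nu%:R 1].
  move=> zt; apply: edge_weight_le_star => //; last exact: deg_sum_edge.
    exact: deg_gt0 zt.
  by rewrite adj_sym in zt; exact: deg_gt0 zt.
have le1 (z t : F) : adj z t ->
    edge_weight a (deg z)%:R (deg t)%:R <= edge_weight a nu%:R 1.
  by case/cmp => [[-> ->]|[-> ->]|/ltW]; rewrite // edge_weightC.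
case: (cmp _ _ xy) => [|| lt]; [by left|by right|].
move: le; rewrite leNgt => /negP[].
rewrite (bigD1 x) //= [ltRHS](bigD1 x) //=; apply: ltr_leD; last first.
  by apply: ler_sum => z _; apply: ler_sum => t; apply: le1.
rewrite (bigD1 y) //= [ltRHS](bigD1 y) //=; apply: ltr_leD => //.
by apply: ler_sum => t /andP[xt _]; apply: le1.
Qed.

End Dominating.

(** * Stars, and the isomorphism with H *)

Section StarCenter.
Variables (K : sgraph) (z : K).
Hypothesis center : forall x y : K, adj x y -> (z == x) || (z == y).

Lemma card_edges_center : #|edges K| = deg z.
Proof.
rewrite -card_edges_at; congr #|pred_of_set _|; apply/eqP.
rewrite eqEsubset edges_at_sub andbT; apply/subsetP => e /edgesP[x [y [xy ->]]].
by rewrite in_edges_at // center.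
Qed.

Lemma deg_leaf (x : K) : adj z x -> deg x = 1%N.
Proof.
move=> zx; rewrite -(cards1 z) /deg; apply: eq_card => y; rewrite !inE.
have [->|yz] := eqVneq y z; first by rewrite adj_sym.
apply/negbTE/negP => /center /orP[]/eqP E; subst; last by rewrite eqxx in yz.
by rewrite adj_irrefl in zx.
Qed.

Lemma center_deg (x y : K) : adj x y ->
  deg x = #|edges K| /\ deg y = 1%N \/ deg x = 1%N /\ deg y = #|edges K|.
Proof.
rewrite card_edges_center => xy; case/orP: (center xy) => /eqP E; rewrite -E in xy *.
  by left; rewrite (deg_leaf xy).
by right; rewrite adj_sym in xy; rewrite (deg_leaf xy).
Qed.

End StarCenter.

(** An end of degree [#|edges K|] lies on every edge, since [edges_at z] is then all of [edges K].
    The neighbour [t] is recorded because it later shows that [z] is not the isolated vertex [c]. *)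
Lemma center_exists (K : sgraph) :
    (forall x y : K, adj x y -> deg x = #|edges K| /\ deg y = 1%N \/
                                deg x = 1%N /\ deg y = #|edges K|) ->
    (0 < #|edges K|)%N ->
  exists z t : K, adj z t /\ forall x y, adj x y -> (z == x) || (z == y).
Proof.
move=> star /card_gt0P[e /edgesP[x [y [xy _]]]].
have [z [t [zt dz]]] : exists z t : K, adj z t /\ deg z = #|edges K|.
  case: (star _ _ xy) => -[dx dy]; first by exists x, y.
  by exists y, x; rewrite adj_sym.
exists z, t; split=> // a b ab; rewrite -in_edges_at //.
have /eqP -> : edges_at z == edges K.
  by rewrite eqEcard edges_at_sub card_edges_at dz /=.
by rewrite in_edges.
Qed.

Lemma dom_star_isomorphic (G : sgraph) (c z : G) :
    (forall x, x != c -> adj c x) -> z != c ->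
    (forall x y : isolate c, adj x y -> ((z : isolate c) == x) || ((z : isolate c) == y)) ->
  isomorphic G (Hgraph #|G| #|edges (isolate c)|).
Proof.
move=> dom zc center; rewrite (card_edges_center center).
set nu := deg _; pose B := [set y | isolate_adj c z y].
have BE : #|B| = nu by [].
have cB : c \notin B by rewrite inE /isolate_adj eqxx !andbF.
have zB : z \notin B by rewrite inE /isolate_adj adj_irrefl.
(* Adjacency in the three-clause shape of [H_adj], with [c], [z], [B] for 0, 1 and the range 2, ...,
   nu + 1. *)
have adjE x y : adj x y =
    [|| (x == c) (+) (y == c), (x == z) && (y \in B) | (y == z) && (x \in B)].
  have [->|xc] := eqVneq x c.
    rewrite (adj_dom dom) (negbTE cB) andbF orbF [c == z]eq_sym (negbTE zc) orbF.
    by [].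
  have [->|yc] := eqVneq y c; first by rewrite adj_sym dom.
  have -> : adj x y = adj (x : isolate c) y by rewrite isolateE /isolate_adj xc yc !andbT.
  rewrite /= !inE; apply/idP/orP => [xy|].
    case/orP: (center _ _ xy) => /eqP E; rewrite -?E in xy *.
      by left; rewrite eqxx.
    by right; rewrite eqxx isolate_sym.
  by case=> /andP[/eqP-> //]; rewrite isolate_sym.
(* The isomorphism is the position in this list, whose order follows the numbering of H. *)
pose s := c :: z :: enum B ++ enum (~: (c |: (z |: B))).
have s_all x : x \in s.
  rewrite !inE mem_cat !mem_enum !inE.
  by case: (x == c); case: (x == z) => //=; case: (isolate_adj c z x).
have s_size : size s = #|G|.
  have czB : c \notin z |: B by rewrite in_setU1 negb_or eq_sym zc.
  by rewrite /= size_cat -!cardE -(cardsC (c |: (z |: B))) !cardsU1 czB zB; lia.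
have idx x : (index x s < #|G|)%N by rewrite -s_size index_mem.
pose f x : Hgraph #|G| nu := Ordinal (idx x).
have i0 x : (index x s == 0)%N = (x == c) by rewrite /= [x == c]eq_sym; case: (c == x).
have i1 x : (index x s == 1)%N = (x == z).
  rewrite /= [x == z]eq_sym; have [<-|_] := eqVneq c x; first by rewrite (negbTE zc).
  by case: (z == x).
have iB x : (2 <= index x s < nu + 2)%N = (x \in B).
  rewrite /=; have [<-|_] := eqVneq c x; first by rewrite (negbTE cB).
  have [<-|_] := eqVneq z x; first by rewrite (negbTE zB).
  rewrite index_cat mem_enum /= addn2 !ltnS -BE cardE.
  case: ifP => xB; first by rewrite index_mem mem_enum.
  by rewrite ltnNge leq_addr.
exists f; last first.
  by move=> x y; rewrite /= /H_adj /star_adj /extra_adj /= -/(index _ s) !i0 !i1 !iB adjE.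
apply: inj_card_bij; last by rewrite card_ord.
move=> x y /(congr1 val) /= E.
by rewrite -(nth_index c (s_all x)) -(nth_index c (s_all y)) /= E.
Qed.

(** * The index and the cyclomatic number of H *)

Section HGraph.
Variables (n nu : nat).
Hypothesis nun : (nu + 2 <= n)%N.

Let lt0 : (0 < n)%N. Proof. by lia. Qed.
Let lt1 : (1 < n)%N. Proof. by lia. Qed.
Let c : Hgraph n nu := Ordinal lt0.
Let z : Hgraph n nu := Ordinal lt1.

Lemma Hgraph_dom x : x != c -> adj c x.
Proof. by rewrite -val_eqE /= /H_adj /star_adj /= => /negbTE->. Qed.

Lemma Hgraph_isolateE (x y : Hgraph n nu) :
  isolate_adj c x y = extra_adj nu x y || extra_adj nu y x.
Proof.
rewrite /isolate_adj /= /H_adj /star_adj /extra_adj -!val_eqE /=.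
by case: (val x) => [|[|i]]; case: (val y) => [|[|j]]; rewrite //= ?andbT ?orbF.
Qed.

Lemma Hgraph_center (x y : isolate c) :
  adj x y -> ((z : isolate c) == x) || ((z : isolate c) == y).
Proof.
rewrite isolateE Hgraph_isolateE -!val_eqE /= ![1%N == _]eq_sym.
by case/orP => /andP[-> _]; rewrite ?orbT.
Qed.

(** All edges left after isolating 0 meet vertex 1, whose neighbours are the shift of ['I_nu] by 2;
    [nun] keeps the shift inside ['I_n]. *)
Lemma card_edges_Hgraph_isolate : #|edges (isolate c)| = nu.
Proof.
rewrite (card_edges_center Hgraph_center).
have lt_g (i : 'I_nu) : (i + 2 < n)%N by have := ltn_ord i; lia.
pose g i : Hgraph n nu := Ordinal (lt_g i).
have g_inj : injective g by move=> i j /(congr1 val) /= /addIn /val_inj.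
rewrite -[RHS]card_ord -(card_imset _ g_inj) /deg; apply: eq_card => x.
rewrite !inE isolateE Hgraph_isolateE /extra_adj /= andbF orbF.
apply/idP/imsetP => [/andP[x2 xnu]|[i _ ->]]; last by rewrite /= leq_addl ltn_add2r ltn_ord.
have lt : (x - 2 < nu)%N by lia.
by exists (Ordinal lt) => //; apply: val_inj; rewrite /= subnK.
Qed.

Lemma cyclomatic_Hgraph : cyclomatic (Hgraph n nu) = nu%:Z.
Proof. by rewrite (cyclomatic_dom Hgraph_dom) card_edges_Hgraph_isolate. Qed.

Lemma card_Hgraph : #|Hgraph n nu| = n.
Proof. exact: card_ord. Qed.

Lemma SOred_Hgraph (R : realType) : SOred R (Hgraph n nu) = SO_bound R n nu.
Proof.
have n2 : (1 < #|Hgraph n nu|)%N by rewrite card_Hgraph.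
rewrite (SOred_dom_star Hgraph_dom R n2) ?card_edges_Hgraph_isolate ?card_Hgraph //.
by have := center_deg Hgraph_center; rewrite card_edges_Hgraph_isolate.
Qed.

End HGraph.

(** * Maximal graphs and the theorem *)

Lemma components_gt0 (K : sgraph) (x : K) : (0 < components K)%N.
Proof.
apply/card_gt0P; exists (fingraph.root (@adj K) x); rewrite !inE.
by rewrite roots_root //; apply: sym_connect_sym (@adj_sym K).
Qed.

Lemma maximal_dominating (R : realType) (n nu : nat) (G : sgraph) :
    (nu + 2 <= n)%N -> maximal_SOred R n nu G -> (2 < n)%N \/ components G = 1%N ->
  exists c : G, forall x, x != c -> adj c x.
Proof.
move=> nun [cardG cycG maxG] side.
have [x0 _] : exists x : G, x \in G by apply/card_gt0P; rewrite cardG; lia.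
pose c := [arg max_(i > x0) deg i]; exists c.
have cmax (x : G) : (deg x <= deg c)%N by rewrite /c; case: arg_maxnP => // i _ /(_ x isT).
(* Otherwise Kelmans' move from [w] to [c] would contradict maximality. *)
have closed2 (w x : G) : adj c w -> adj w x -> x != c -> adj c x.
  move=> cw wx xc; apply/negPn/negP => ncx.
  have P0 : private_nbrs c w != set0.
    by apply/set0Pn; exists x; rewrite inE wx ncx xc.
  have := SOred_kelmans cw R (cmax w) P0; rewrite ltNge maxG //.
  by rewrite cyclomatic_kelmans.
have conn x : connect (@adj G) c x -> x != c -> adj c x.
  have cl : closed (@adj G) [pred x | (x == c) || adj c x].
    apply: intro_closed; first exact: sym_connect_sym (@adj_sym G).
    move=> y x' yx; rewrite !inE => /orP[/eqP E|cy].
      by rewrite -E yx orbT.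
    by have [//|xc] := eqVneq x' c; apply: closed2 yx xc.
  by move=> /(closed_connect cl); rewrite !inE eqxx => /esym/orP[->|].
move=> x xc; apply: conn => //; apply/negPn/negP => ncx.
case: side => [n2|comp1]; last first.
  have := components_bridge ncx; rewrite comp1 => -[/esym/eqP].
  by rewrite eqn0Ngt (@components_gt0 (bridge ncx) c).
(* If [c] has a neighbour, a bridge to [x] contradicts maximality. Otherwise G is edgeless with
   index 0, while H has positive index because its last root is positive for [n > 2]. *)
have [c0|c0] := posnP (deg c); last first.
  have := SOred_bridge ncx R c0; rewrite ltNge maxG //.
  by rewrite cyclomatic_bridge.
have := maxG (Hgraph n nu) (card_Hgraph _ _) (cyclomatic_Hgraph nun).
have -> : SOred R G = 0.
  apply: (@pmulrnI _ 2) => //; rewrite mul0rn SOred2 big1 // => y _.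
  rewrite big_pred0 // => t; apply/negP => /deg_gt0.
  by have := cmax y; rewrite c0; case: (deg y).
rewrite SOred_Hgraph // leNgt => /negP[].
have n20 : (0 : R) < n%:R - 2 by rewrite subr_gt0 ltr_nat.
have nu0 : (0 : R) <= n%:R - nu%:R - 2.
  by rewrite -addrA -opprD -natrD subr_ge0 ler_nat.
rewrite /SO_bound; apply: ltr_wpDl; last first.
  by rewrite sqrtr_gt0 ltr_wpDr ?sqr_ge0 // exprn_gt0.
by rewrite !addr_ge0 // mulr_ge0 ?sqrtr_ge0 // ltW.
Qed.

Lemma SOred_card2 (R : realType) (G : sgraph) : #|G| = 2%N -> SOred R G = 0.
Proof.
move=> G2; apply: (@pmulrnI _ 2) => //; rewrite mul0rn SOred2 big1 // => x _.
apply: big1 => y xy.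
have deg1 (a b : G) : adj a b -> deg a = 1%N.
  by move=> /deg_gt0; have := deg_ltn a; rewrite G2; case: (deg a) => [|[]].
rewrite (deg1 _ _ xy) (deg1 y x) 1?adj_sym // subrr.
exact: hyp0.
Qed.

(** The alternative before the isomorphism excludes a tie: for n = 2 and nu = 0 the edgeless graph
    and the single edge both have index 0 and cyclomatic number 0, so both are maximal. *)
Theorem theorem3p8 (R : realType) (n nu : nat) (G : sgraph) :
  (nu + 2 <= n)%N ->
  maximal_SOred R n nu G ->
  ((2 < n)%N \/ components G = 1%N -> isomorphic G (Hgraph n nu)) /\
  SOred R G =
    (n%:R - nu%:R - 2) * (n%:R - 2)
    + nu%:R * Num.sqrt ((n%:R - 2) ^+ 2 + 1)
    + nu%:R * Num.sqrt (nu%:R ^+ 2 + 1)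
    + Num.sqrt ((n%:R - 2) ^+ 2 + nu%:R ^+ 2).
Proof.
move=> nun maxG; have [cardG cycG leG] := maxG; rewrite -/(SO_bound R n nu).
have key : (2 < n)%N \/ components G = 1%N ->
    isomorphic G (Hgraph n nu) /\ SOred R G = SO_bound R n nu.
  move=> /(maximal_dominating nun maxG)[c dom].
  have := cyclomatic_dom dom; rewrite cycG => -[/esym cardF].
  (* H is itself a competitor, which supplies the lower bound that forces star type on every edge of
     F. *)
  have leH : SO_bound R n nu <= SOred R G.
    by rewrite -SOred_Hgraph // leG ?card_Hgraph ?cyclomatic_Hgraph.
  have star := SOred_dom_bound dom (R := R).
  rewrite cardF cardG in star; move: star => /(_ nun leH) star.
  split; last first.
    by rewrite (SOred_dom_star dom R) ?cardF ?cardG //; lia.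
  suff [z [zc center]] : exists z : G, z != c /\ forall x y : isolate c, adj x y ->
      ((z : isolate c) == x) || ((z : isolate c) == y).
    by have := dom_star_isomorphic dom zc center; rewrite cardF cardG.
  (* If [nu = 0], F has no edges and any vertex other than [c] serves as center. *)
  have [nu0|nu0] := posnP nu.
    have [z zc] : exists z, z \in predC1 c.
      by apply/card_gt0P; rewrite cardC1 cardG; lia.
    exists z; split=> // x y xy.
    have : [set x; y] \in edges (isolate c) by rewrite in_edges.
    by move: cardF; rewrite nu0 => /eqP; rewrite cards_eq0 => /eqP->; rewrite inE.
  have [||z [t [zt center]]] := @center_exists (isolate c); rewrite ?cardF //.
  exists z; split=> //.
  by move: zt; rewrite isolateE => /and3P[].
have [n2|n2] := ltnP 2 n; first by have [] := key (or_introl n2); split.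
split=> [[//|comp1]|]; first by have [] := key (or_intror comp1).
(* In the remaining case n = 2 both sides are 0, whether or not G has its edge. *)
have -> : nu = 0%N by lia.
have nE : n = 2%N by lia.
rewrite SOred_card2 ?cardG // nE /SO_bound.
by rewrite mulr0n subr0 subrr !mul0r !add0r !expr0n /= addr0 sqrtr0.
Qed.
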